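(* Let $B\subset\mathbb{R}^4$ be an open set, let $f=(f^1,f^2,f^3):B\to T^3$ be a smooth map, let $X=B\times T^3$ carry the flat metric and the standard $G_2$-structure $\varphi$, and let $S=\{(y,f(y))\mid y\in B\}\subset X$ be the graph of $f$. Let $$F^S_\nabla=\sqrt{-1}\sum_{j=1}^3\sum_{a=4}^7\frac{\partial f^j}{\partial y^a}\,dy^a\wedge dx^j$$ be the curvature of the real Fourier--Mukai transform of $S$. Then the following are equivalent. (1) $S$ is a coassociative submanifold for an appropriate orientation. (2) $\frac16(F^S_\nabla)^3+F^S_\nabla\wedge*\varphi=0$. (3) $\frac16(F^S_\nabla)^3+F^S_\nabla\wedge*\varphi=0$ and $\varphi\wedge*\big((F^S_\nabla)^2\big)=0$.
   Context: $T^3=\mathbb{R}^3/(2\pi\mathbb{Z})^3$. Coordinates on $B$ are $(y^4,y^5,y^6,y^7)$ and on $T^3$ are $(x^1,x^2,x^3)$; $X=B\times T^3$ has the flat metric $\sum(dx^i)^2+\sum(dy^a)^2$ and orientation $dx^{123}\wedge dy^{4567}$; $*$ is the Hodge star; powers of forms are wedge powers and $dx^{ij}=dx^i\wedge dx^j$, etc. Set $\omega_1=dy^{45}+dy^{67}$, $\omega_2=dy^{46}+dy^{75}$, $\omega_3=-(dy^{47}+dy^{56})$. The standard $G_2$-structure and its Hodge dual are $\varphi=dx^{123}+\sum_{i=1}^3dx^i\wedge\omega_i$ and $*\varphi=dy^{4567}+dx^{12}\wedge\omega_3+dx^{23}\wedge\omega_1+dx^{31}\wedge\omega_2$. Coassociative: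 an oriented 4-dimensional submanifold calibrated by $*\varphi$, i.e. $*\varphi$ restricts to the induced volume form. Real Fourier--Mukai transform of $S$: identifying $B\times(T^3)^*$ with $X$, the Hermitian connection $d+\sqrt{-1}\sum_{j=1}^3f^jdx^j$ of the trivial complex line bundle over $X$. (The components $f^j$ are defined modulo $2\pi$, so their derivatives are well-defined functions on $B$.) *)

(* Defs.v *)
From HB Require Import structures.
From mathcomp Require Import all_boot all_order all_algebra.
From mathcomp Require Import generic_quotient complex.
From mathcomp Require Import all_classical all_reals all_analysis.

Set Implicit Arguments.
Unset Strict Implicit.
Unset Printing Implicit Defensive.

Import Order.TTheory GRing.Theory Num.Theory.
Import numFieldNormedType.Exports.

Local Open Scope ring_scope.

Reserved Notation "a \wedge b" (at level 40, left associativity).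

(* [form K n] is the exterior algebra over K on the coordinate covectors
   e_1, ..., e_n: [a] stands for the sum of the a(I) e_I, where
   e_I = e_{i1} /\ ... /\ e_{ik} for I = {i1 < ... < ik}.  Forms of mixed degree
   are allowed.  A differential form on an n-dimensional flat space with global
   coordinate coframe is a function into [form K n]. *)
Definition form (K : comNzRingType) (n : nat) := {ffun {set 'I_n} -> K^o}.

Section ExteriorAlgebra.
Variables (K : comNzRingType) (n : nat).
Local Notation form := (form K n).

(* For disjoint I and J, e_I /\ e_J = shuffle_sign I J *: e_(I :|: J). *)
Definition shuffle_sign (I J : {set 'I_n}) : K :=
  (-1) ^+ #|[set ij : 'I_n * 'I_n | [&& ij.1 \in I, ij.2 \in J & (ij.2 < ij.1)%N]]|.

Definition monomial (I : {set 'I_n}) : form := [ffun J : {set 'I_n} => (J == I)%:R].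

Definition wedge (a b : form) : form :=
  [ffun I : {set 'I_n} => \sum_(J : {set 'I_n} | J \subset I)
               shuffle_sign J (I :\: J) * a J * b (I :\: J)].

Definition wedge_exp (a : form) (k : nat) : form := iter k (wedge a) (monomial finset.set0).

(* Hodge star (K-linear) of the metric for which the e_i are orthonormal and of
   the orientation e_1 /\ ... /\ e_n: it maps e_J to shuffle_sign J J^c e_{J^c}. *)
Definition hodge (a : form) : form :=
  [ffun I : {set 'I_n} => shuffle_sign (~: I) I * a (~: I)].

(* The degree k part of [a], evaluated on the k rows of M. *)
Definition form_eval (k : nat) (a : form) (M : 'M[K]_(k, n)) : K :=
  \sum_(s : {ffun 'I_k -> 'I_n} |
          [forall i : 'I_k, forall j : 'I_k, (i < j)%N ==> (s i < s j)%N])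
     a [set s i | i in 'I_k] * \det (colsub s M).

End ExteriorAlgebra.

Notation "a \wedge b" := (wedge a b) : ring_scope.

Section StandardG2.
Variable K : comNzRingType.

(* With 1-based k: dx^k for k = 1, 2, 3 and dy^k for k = 4, 5, 6, 7. *)
Definition d_ (k : nat) : form K 7 := monomial K [set inord k.-1].

Definition omega1 := d_ 4 \wedge d_ 5 + d_ 6 \wedge d_ 7.
Definition omega2 := d_ 4 \wedge d_ 6 + d_ 7 \wedge d_ 5.
Definition omega3 := - (d_ 4 \wedge d_ 7 + d_ 5 \wedge d_ 6).

Definition phiG2 : form K 7 :=
  d_ 1 \wedge d_ 2 \wedge d_ 3
  + (d_ 1 \wedge omega1 + d_ 2 \wedge omega2 + d_ 3 \wedge omega3).

End StandardG2.

Section Torus.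
Variable R : realType.

Definition torus_eqb (u v : 'rV[R]_3) : bool :=
  `[< exists k : 'rV[int]_3, u - v = (2 * pi) *: map_mx intr k >].

Fact torus_eqb_equiv : equiv_class_of torus_eqb.
Proof.
split.
- move=> u; apply/asboolP; exists 0.
  by rewrite subrr map_mx0 scaler0.
- suff sym u v : torus_eqb u v -> torus_eqb v u.
    by move=> u v; apply/idP/idP; exact: sym.
  move=> /asboolP[k uv]; apply/asboolP; exists (- k).
  by rewrite map_mxN scalerN -uv opprB.
- move=> v u w /asboolP[k uv] /asboolP[l vw]; apply/asboolP; exists (k + l).
  by rewrite map_mxD scalerDr -uv -vw addrA subrK.
Qed.

Canonical torus_equiv := EquivRelPack torus_eqb_equiv.

(* R^3 / (2 pi Z)^3 with the quotient topology *)
Definition torus3 := quotient_topology {eq_quot torus_equiv}%qT.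

HB.instance Definition _ := Topological.on torus3.
HB.instance Definition _ := Quotient.on torus3.

Definition to_torus (u : 'rV[R]_3) : torus3 := (\pi_torus3 u)%qT.

End Torus.
Arguments to_torus {R}.

Section Smooth.
Variables (R : realType) (V W : normedModType R).

(* C^k on a set meant to be open; for finite-dimensional V this is the usual
   notion, the derivative being C^k iff all directional derivatives are. *)
Fixpoint Ck_on (k : nat) (U : set V) (g : V -> W) : Prop :=
  match k with
  | 0 => forall u, U u -> {for u, continuous g}
  | k'.+1 => (forall u, U u -> differentiable g u) /\
             (forall v, Ck_on k' U (fun u => 'D_v g u))
  end.

Definition smooth_on (U : set V) (g : V -> W) := forall k, Ck_on k U g.

End Smooth.

Local Open Scope classical_set_scope.

Section TorusMaps.
Variable R : realType.
Implicit Types (B : set 'rV[R]_4) (f : 'rV[R]_4 -> torus3 R) (y : 'rV[R]_4).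

Definition local_lift B f y (g : 'rV[R]_4 -> 'rV[R]_3) :=
  exists U, [/\ open U, U y, U `<=` B, smooth_on U g &
                forall z, U z -> to_torus (g z) = f z].

Definition smooth_to_torus B f := forall y, B y -> exists g, local_lift B f y g.

(* The derivative of f^(j+1) along y^(a+4) at y.  Two local lifts differ near y
   by a constant in (2 pi Z)^3, so the choice of the lift is immaterial. *)
Definition partial_torus B f y (j : 'I_3) (a : 'I_4) : R :=
  ('D_(delta_mx 0 a) (xget (fun=> 0) (local_lift B f y)) y) 0 j.

End TorusMaps.

Section Submanifolds.
Variable R : realType.

(* X = B x T^3 is a subset of R^4 x T^3. *)
Definition totalX (B : set 'rV[R]_4) : set ('rV[R]_4 * torus3 R) := B `*` setT.

(* The universal covering of R^4 x T^3, in coordinates (x^1,x^2,x^3,y^4,...,y^7).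
   It is locally an isometry, and identifies all tangent spaces of X with 'rV_7
   with its standard metric. *)
Definition cover (z : 'rV[R]_(3 + 4)) : 'rV[R]_4 * torus3 R :=
  (rsubmx z, to_torus (lsubmx z)).

(* [cover \o g] restricted to U is a local parametrization of the embedded
   4-dimensional submanifold S: an immersion which is a homeomorphism onto an
   open subset of S. *)
Definition local_param (S : set ('rV[R]_4 * torus3 R)) (U : set 'rV[R]_4)
    (g : 'rV[R]_4 -> 'rV[R]_7) :=
  [/\ open U,
      smooth_on U g,
      forall u, U u -> row_free ('J g u),
      forall u v, U u -> U v -> cover (g u) = cover (g v) -> u = v &
      forall V, open V -> V `<=` U ->
        exists W, open W /\ (cover \o g) @` V = S `&` W].

(* Row i of ['J g u] is the i-th partial derivative of g at u, so that the last
   condition says that the coordinate bases given by two parametrizations of A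
   define the same orientation of each tangent space. *)
Definition oriented_atlas (S : set ('rV[R]_4 * torus3 R))
    (A : set (set 'rV[R]_4 * ('rV[R]_4 -> 'rV[R]_7))) :=
  [/\ forall U g, A (U, g) -> local_param S U g,
      forall p, S p -> exists U g u, [/\ A (U, g), U u & cover (g u) = p] &
      forall U g V h u v, A (U, g) -> A (V, h) -> U u -> V v ->
        cover (g u) = cover (h v) ->
        exists2 M : 'M[R]_4, 0 < \det M & 'J g u = M *m 'J h v].

(* The pullback of *phi by each oriented parametrization is that of the induced
   volume form, sqrt(det(g_ij)) du^1 /\ ... /\ du^4. *)
Definition calibrated (A : set (set 'rV[R]_4 * ('rV[R]_4 -> 'rV[R]_7))) :=
  forall U g u, A (U, g) -> U u ->
    form_eval (hodge (phiG2 R)) ('J g u)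
    = Num.sqrt (\det ('J g u *m ('J g u)^T)).

(* S is a coassociative submanifold of X for some orientation. *)
Definition coassociative (B : set 'rV[R]_4) (S : set ('rV[R]_4 * torus3 R)) :=
  S `<=` totalX B /\ exists A, oriented_atlas S A /\ calibrated A.

Definition torus_graph (B : set 'rV[R]_4) (f : 'rV[R]_4 -> torus3 R)
  : set ('rV[R]_4 * torus3 R) := [set (y, f y) | y in B].

End Submanifolds.

(* Curvature of the connection d + i sum_j f^j dx^j on the trivial complex line
   bundle over X. *)
Definition curvature (R : realType) (B : set 'rV[R]_4)
    (f : 'rV[R]_4 -> torus3 R) (p : 'rV[R]_4 * torus3 R) : form R[i] 7 :=
  'i%C *: \sum_(j < 3) \sum_(a < 4)
    (partial_torus B f p.1 j a)%:C%C *: (d_ R[i] (a + 4) \wedge d_ R[i] j.+1).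

(* Main.v *)
(* Write p for the Jacobian matrix of f at a point and S for the graph. The
   four components of the dDT equation are, up to constants, the components E_a
   of the restriction of phi to S, and the three components of
   phi /\ *(F^2) are the combinations \sum_a (+/-) p_aj E_a, so that they vanish
   with the E_a. Evaluating *phi on the tangent 4-vector v of S gives
     *phi(v)^2 + \sum_a E_a^2 + \sum_j (\sum_a (+/-) p_aj E_a)^2 = |v|^2,
   hence S is calibrated by *phi up to sign iff all E_a vanish. The sign of
   *phi(v) may differ from one component of B to another, but it is locally
   constant, so that it can be absorbed in the orientation of S. *)
Require Import Defs.
From HB Require Import structures.
From mathcomp Require Import all_boot all_order all_algebra.
From mathcomp Require Import complex fingroup perm ring.

Set Implicit Arguments.
Unset Strict Implicit.
Unset Printing Implicit Defensive.

Import Order.TTheory GRing.Theory Num.Theory.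

Local Open Scope ring_scope.

(** * Exterior algebra *)

Section Wedge.
Variables (K : comNzRingType) (n : nat).
Implicit Types (a b c : Defs.form K n) (I J : {set 'I_n}).

Lemma wedgeDl a b c : (a + b) \wedge c = a \wedge c + b \wedge c.
Proof.
apply/ffunP => I; rewrite !ffunE -big_split; apply: eq_bigr => J _.
by rewrite ffunE mulrDr mulrDl.
Qed.

Lemma wedgeDr a b c : a \wedge (b + c) = a \wedge b + a \wedge c.
Proof.
apply/ffunP => I; rewrite !ffunE -big_split; apply: eq_bigr => J _.
by rewrite ffunE mulrDr.
Qed.

Lemma wedgeZl k a b : (k *: a) \wedge b = k *: (a \wedge b).
Proof.
apply/ffunP => I; rewrite !ffunE /= /GRing.scale /= mulr_sumr; apply: eq_bigr => J _.
by rewrite ffunE /GRing.scale /= mulrCA !mulrA.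
Qed.

Lemma wedgeZr k a b : a \wedge (k *: b) = k *: (a \wedge b).
Proof.
apply/ffunP => I; rewrite !ffunE /= /GRing.scale /= mulr_sumr; apply: eq_bigr => J _.
by rewrite ffunE /GRing.scale /= mulrCA !mulrA.
Qed.

Lemma wedge0l a : 0 \wedge a = 0.
Proof. by apply/ffunP => I; rewrite !ffunE big1 // => J _; rewrite ffunE mulr0 mul0r. Qed.

Lemma wedge0r a : a \wedge 0 = 0.
Proof. by apply/ffunP => I; rewrite !ffunE big1 // => J _; rewrite ffunE mulr0. Qed.

Lemma wedge_expZ k a d : wedge_exp (k *: a) d = k ^+ d *: wedge_exp a d.
Proof.
elim: d => [|d IHd]; first by rewrite expr0 scale1r.
by rewrite /wedge_exp !iterS -!/(wedge_exp _ _) IHd wedgeZl wedgeZr scalerA exprS.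
Qed.

Lemma hodgeD a b : hodge (a + b) = hodge a + hodge b.
Proof. by apply/ffunP => I; rewrite !ffunE mulrDr. Qed.

Lemma hodgeZ k a : hodge (k *: a) = k *: hodge a.
Proof. by apply/ffunP => I; rewrite !ffunE /= /GRing.scale /= mulrCA. Qed.

Lemma wedge_monomial I J :
  monomial K I \wedge monomial K J =
  if [disjoint I & J] then shuffle_sign K I J *: monomial K (I :|: J) else 0.
Proof.
apply/ffunP => L; rewrite ffunE.
have [dIJ|ndIJ] := boolP [disjoint I & J]; last first.
  rewrite ffunE big1 // => H HL; rewrite !ffunE.
  have [->|_] := eqVneq H I; last by rewrite mulr0 mul0r.
  have [LI|_] := eqVneq (L :\: I) J; last by rewrite mulr0.
  by case/negP: ndIJ; rewrite -LI disjoint_sym disjoints_subset setDE subsetIr.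
rewrite !ffunE /GRing.scale /=.
have [->|LIJ] := eqVneq L (I :|: J).
  rewrite (bigD1 I) ?subsetUl //= big1 => [|H /andP[_ HI]]; last first.
    by rewrite ffunE (negPf HI) mulr0 mul0r.
  have -> : (I :|: J) :\: I = J.
    by rewrite setDUl setDv set0U; apply/setDidPl; rewrite disjoint_sym.
  by rewrite !ffunE !eqxx !mulr1 addr0.
rewrite mulr0 big1 // => H HL; rewrite !ffunE.
have [HI|_] := eqVneq H I; last by rewrite mulr0 mul0r.
have [LI|_] := eqVneq (L :\: H) J; last by rewrite mulr0.
case/eqP: LIJ; rewrite -LI -HI setUC setDE setUIl [~: H :|: H]setUC setUCr setIT.
by apply/esym/setUidPl.
Qed.

Lemma hodge_monomial I :
  hodge (monomial K I) = shuffle_sign K I (~: I) *: monomial K (~: I).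
Proof.
apply/ffunP => L; rewrite !ffunE /GRing.scale /=.
have [->|LI] := eqVneq L (~: I); first by rewrite setCK eqxx.
rewrite (_ : (~: L == I) = false) ?mulr0 //.
by apply: contraNF LI => /eqP <-; rewrite setCK.
Qed.

End Wedge.

(** * Sets of coordinates as Boolean masks *)

Section Masks.
Variables (K : comNzRingType) (n : nat).
Implicit Types (m p q : seq bool).

(** Lists of Booleans reduce under computation while finite sets do not. Unions, complements,
    disjointness and signs are computed on masks and transported along this map. *)
Definition mask_set m : {set 'I_n} := [set i : 'I_n | nth false m i].

Definition inversions p q : nat :=
  sumn [seq count (fun j => nth false q j && (j < i)%N) (iota 0 n)
          | i <- iota 0 n & nth false p i].

Lemma shuffle_sign_mask p q :
  shuffle_sign K (mask_set p) (mask_set q) = (-1) ^+ inversions p q.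
Proof.
congr (_ ^+ _); rewrite -sum1_card.
rewrite (eq_bigl (fun ij : 'I_n * 'I_n => nth false p ij.1 &&
   (nth false q ij.2 && (ij.2 < ij.1)%N))); last by move=> ij; rewrite !inE.
rewrite -(pair_big_dep (fun i : 'I_n => nth false p i)
  (fun i j : 'I_n => nth false q j && (j < i)%N) (fun _ _ => 1%N)) /=.
have iotaE (P : pred nat) F : (\sum_(k <- iota 0 n | P k) F k = \sum_(k < n | P k) F k)%N.
  by rewrite -(big_mkord P F) /index_iota subn0.
rewrite /inversions sumnE big_map big_filter iotaE.
by apply: eq_bigr => i _; rewrite -sum1_count iotaE.
Qed.

Definition mask_or p q := mkseq (fun i => nth false p i || nth false q i) n.
Definition mask_not p := mkseq (fun i => ~~ nth false p i) n.
Definition mask_disjoint p q :=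
  all (fun i => ~~ (nth false p i && nth false q i)) (iota 0 n).

Lemma mask_set_or p q : mask_set (mask_or p q) = mask_set p :|: mask_set q.
Proof. by apply/setP => i; rewrite !inE nth_mkseq. Qed.

Lemma mask_set_not p : mask_set (mask_not p) = ~: mask_set p.
Proof. by apply/setP => i; rewrite !inE nth_mkseq. Qed.

Lemma mask_set_disjoint p q :
  [disjoint mask_set p & mask_set q] = mask_disjoint p q.
Proof.
rewrite disjoints_subset; apply/subsetP/allP => [pq i|pq i].
  rewrite mem_iota => i_n; have := pq (Ordinal i_n).
  by rewrite !inE /=; case: (nth false p i) => //= ->.
rewrite !inE => pi; have := pq i; rewrite mem_iota ltn_ord pi /=; exact.
Qed.

Lemma mask_set_inj p q : size p = n -> size q = n ->
  (mask_set p == mask_set q) = (p == q).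
Proof.
move=> sp sq; apply/eqP/eqP => [/setP pq|->//].
apply: (@eq_from_nth _ false) => [|i]; first by rewrite sp.
by rewrite sp => i_n; have := pq (Ordinal i_n); rewrite !inE.
Qed.

End Masks.

(* Sparse forms whose coefficients are integer polynomials in variables x v, so
   that wedge products can be evaluated by computation: the term (c, vs, m) stands
   for c * \prod_(v <- vs) x v *: e_I, where I is the set of positions of [true]
   in m. *)
Definition sform := seq (int * seq nat * seq bool).

Section SymbolicForms.
Variable n : nat.
Implicit Types (s t : int * seq nat * seq bool) (l : sform).

Definition sterm_wedge s t : sform :=
  if mask_disjoint n s.2 t.2 then
    [:: ((-1) ^+ inversions n s.2 t.2 * (s.1.1 * t.1.1), s.1.2 ++ t.1.2,
         mask_or n s.2 t.2)]
  else [::].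

Definition swedge l1 l2 : sform :=
  flatten [seq flatten [seq sterm_wedge s t | t <- l2] | s <- l1].

Definition shodge l : sform :=
  [seq ((-1) ^+ inversions n t.2 (mask_not n t.2) * t.1.1, t.1.2, mask_not n t.2)
     | t <- l].

Definition sscale (c : int) l : sform := [seq (c * t.1.1, t.1.2, t.2) | t <- l].

Fixpoint sinsert s l : sform :=
  if l is t :: l' then
    if (t.1.2 == s.1.2) && (t.2 == s.2)
    then (s.1.1 + t.1.1, s.1.2, s.2) :: l' else t :: sinsert s l'
  else [:: s].

(** Sorting the variables gives equal monomials the same list, so that [sinsert] merges them; terms
    whose coefficients have cancelled are dropped. *)
Definition scollect l : sform :=
  [seq t <- foldr (fun t => sinsert (t.1.1, sort leq t.1.2, t.2)) [::] l
     | t.1.1 != 0].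

Variables (K : comNzRingType) (x : nat -> K).

Definition scoef t : K := t.1.1%:~R * \prod_(v <- t.1.2) x v.

Definition interp l : Defs.form K n :=
  \sum_(t <- l) scoef t *: monomial K (mask_set n t.2).

Lemma interp_cat l1 l2 : interp (l1 ++ l2) = interp l1 + interp l2.
Proof. exact: big_cat. Qed.

Lemma interp_swedge l1 l2 : interp (swedge l1 l2) = interp l1 \wedge interp l2.
Proof.
rewrite /interp /swedge big_flatten big_map /=.
rewrite (big_morph (fun a => a \wedge _) (fun a b => wedgeDl a b _) (wedge0l _)).
apply: eq_bigr => s _; rewrite big_flatten big_map /=.
rewrite (big_morph _ (wedgeDr _) (wedge0r _)).
apply: eq_bigr => t _; rewrite wedgeZl wedgeZr wedge_monomial mask_set_disjoint.
rewrite /sterm_wedge; case: ifP => _; last by rewrite big_nil !scaler0.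
rewrite big_seq1 mask_set_or shuffle_sign_mask !scalerA /scoef /= big_cat /=.
by congr (_ *: _); rewrite !rmorphM /= rmorphXn rmorphN1; ring.
Qed.

Lemma interp_shodge l : interp (shodge l) = hodge (interp l).
Proof.
have h0 : hodge (0 : Defs.form K n) = 0.
  by apply/ffunP => I; rewrite !ffunE mulr0.
rewrite /interp /shodge big_map (big_morph _ (@hodgeD _ _) h0).
apply: eq_bigr => t _; rewrite hodgeZ hodge_monomial -mask_set_not.
rewrite shuffle_sign_mask scalerA /scoef /=.
by congr (_ *: _); rewrite rmorphM /= rmorphXn rmorphN1; ring.
Qed.

Lemma interp_sscale c l : interp (sscale c l) = c%:~R *: interp l.
Proof.
rewrite /interp big_map scaler_sumr; apply: eq_bigr => t _.
by rewrite scalerA /scoef /= rmorphM /= mulrA.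
Qed.

Lemma interp_sinsert s l :
  interp (sinsert s l) = scoef s *: monomial K (mask_set n s.2) + interp l.
Proof.
rewrite /interp; elim: l => [|t l IHl] /=; first by rewrite big_seq1 big_nil addr0.
case: ifP => [/andP[/eqP v /eqP m]|_]; rewrite !big_cons ?IHl; last exact: addrCA.
by rewrite /= addrA m -scalerDl /scoef /= v rmorphD mulrDl.
Qed.

Lemma interp_scollect l : interp (scollect l) = interp l.
Proof.
rewrite /scollect; set l' := foldr _ _ _.
have -> : interp [seq t <- l' | t.1.1 != 0] = interp l'.
  rewrite /interp big_filter big_mkcond; apply: eq_bigr => t _.
  by case: eqP => //= t0; rewrite /scoef t0 mul0r scale0r.
rewrite /l'; elim: l {l'} => [|t l IHl] //=.
rewrite interp_sinsert IHl /interp big_cons /scoef /=.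
by rewrite (perm_big t.1.2) //= perm_sort.
Qed.

Definition scoef_at l (m : seq bool) : K := \sum_(t <- l | t.2 == m) scoef t.

(** Masks of length [n] are determined by their sets, so [scoef_at l m] is the coefficient of
    [interp l] at the set of [m]. At a set that comes from no mask in [l], every term vanishes. *)
Lemma interp_eq0 l : all (fun t => size t.2 == n) l ->
  interp l = 0 <-> {in undup [seq t.2 | t <- l], forall m, scoef_at l m = 0}.
Proof.
move=> /allP sl.
have interpE m : size m = n -> interp l (mask_set n m) = scoef_at l m.
  move=> sm; rewrite /interp /scoef_at sum_ffunE [RHS]big_mkcond /=.
  rewrite [LHS]big_seq [RHS]big_seq.
  apply: eq_bigr => t /sl/eqP st; rewrite !ffunE /GRing.scale /= mask_set_inj // eq_sym.
  by case: eqP; rewrite (mulr1, mulr0).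
split=> [l0 m|l0].
  rewrite mem_undup => /mapP[t /sl/eqP st ->].
  by rewrite -interpE // l0 ffunE.
apply/ffunP => I; rewrite ffunE.
have [/hasP[t tl /eqP <-]|/hasPn nI] := boolP (has (fun t => mask_set n t.2 == I) l).
  rewrite interpE; last exact/eqP/sl.
  by apply: l0; rewrite mem_undup map_f.
rewrite /interp sum_ffunE big_seq big1 // => t /nI tI.
by rewrite !ffunE eq_sym (negPf tI) scaler0.
Qed.

End SymbolicForms.

(** * The tangent space of a graph *)

Section Minors.
Variable K : comNzRingType.
Implicit Types (F p : nat -> nat -> K).
Local Notation "p [# i , j ]" := (p i%N j%N) (at level 1, left associativity).

(** Expansion along the first row, [bump j] skipping column [j]. Indices in [nat] and a [foldr] over
    [iota] let it unfold to an explicit polynomial. *)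
Fixpoint laplace n F : K :=
  if n isn't m.+1 then 1 else
  foldr (fun j d => (-1) ^+ j * F[# 0, j] * laplace m (fun i k => F i.+1 (bump j k)) + d)
    0 (iota 0 n).

Lemma det_laplace n F : \det (\matrix_(i < n, j < n) F i j) = laplace n F.
Proof.
elim: n F => [|n IHn] F; first exact: det_mx00.
have foldrE G m : foldr (fun j d => G j + d) 0 (iota 0 m) = \sum_(j < m) G j :> K.
  rewrite -(big_mkord predT G) /index_iota subn0.
  by elim: (iota 0 m) => [|j r IHr]; rewrite ?big_nil ?big_cons /= ?IHr.
rewrite /laplace -/laplace foldrE.
rewrite (expand_det_row _ ord0); apply: eq_bigr => j _.
rewrite !mxE /cofactor mulrCA mulrA add0n -IHn; congr (_ * \det _).
by apply/matrixP => i k; rewrite !mxE.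
Qed.

Definition minor2 p a b i j := p a i * p b j - p b i * p a j.

Definition minor3 p a b c :=
  p[# a, 0] * minor2 p b c 1 2 - p[# a, 1] * minor2 p b c 0 2
  + p[# a, 2] * minor2 p b c 0 1.

(* For p[# a, j] the derivative of f^(j+1) along y^(a+4), the value of *phi on
   the coordinate basis of the tangent space of the graph of f. *)
Definition star_eval p : K :=
  1 + minor2 p 0 1 1 2 + minor2 p 2 3 1 2 + minor2 p 0 2 2 0
  - minor2 p 1 3 2 0 - minor2 p 0 3 0 1 - minor2 p 1 2 0 1.

(* [defect p a] is the coefficient of the product of the dy^b, b != a + 4, in
   the restriction df^123 + \sum_i df^i /\ omega_i of phi to the graph of f. *)
Definition defect p : nat -> K := nth 0 [::
  p[# 1, 0] + p[# 2, 1] - p[# 3, 2] + minor3 p 1 2 3;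
  p[# 0, 0] + p[# 2, 2] + p[# 3, 1] + minor3 p 0 2 3;
  p[# 3, 0] - p[# 0, 1] + p[# 1, 2] + minor3 p 0 1 3;
  p[# 2, 0] - p[# 1, 1] - p[# 0, 2] + minor3 p 0 1 2].

(* The cubic terms cancel: these are, up to sign, the components of
   phi /\ *(F^2) / 2. *)
Definition defect_comb p j :=
  p[# 0, j] * defect p 0 - p[# 1, j] * defect p 1
  + p[# 2, j] * defect p 2 - p[# 3, j] * defect p 3.

(** Entries of P P^T + 1, the metric induced by y |-> (f(y), y) when P is the derivative of f. *)
Definition gram p i k := p[# i, 0] * p[# k, 0] + p[# i, 1] * p[# k, 1]
  + p[# i, 2] * p[# k, 2] + (i == k)%:R.

(* Harvey and Lawson's identity *phi(v)^2 + |chi(v)|^2 = |v|^2, for v the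
   4-vector of the graph and chi the coassociator. *)
Lemma laplace_gram p : laplace 4 (gram p) = star_eval p ^+ 2
  + (defect p 0 ^+ 2 + defect p 1 ^+ 2 + defect p 2 ^+ 2 + defect p 3 ^+ 2)
  + (defect_comb p 0 ^+ 2 + defect_comb p 1 ^+ 2 + defect_comb p 2 ^+ 2).
Proof.
rewrite /laplace /bump /=.
rewrite /gram /star_eval /defect_comb /defect /minor3 /minor2 /= ?(addr0, mulr1n).
(* Once the entries are generalized, an identity between polynomials in twelve independent variables
   remains. *)
move: p[# 0, 0] p[# 0, 1] p[# 0, 2] => p00 p01 p02.
move: p[# 1, 0] p[# 1, 1] p[# 1, 2] => p10 p11 p12.
move: p[# 2, 0] p[# 2, 1] p[# 2, 2] => p20 p21 p22.
move: p[# 3, 0] p[# 3, 1] p[# 3, 2] => p30 p31 p32.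
ring.
Qed.

End Minors.

(** * The $G_2$-structure and the curvature as symbolic forms *)

Definition sd (k : nat) : sform := [:: (1%:Z, [::], mkseq (eq_op k.-1) 7)].
Definition sneg := sscale (- 1%:Z).
Local Notation "a ^^ b" := (swedge 7 a b) (at level 40, left associativity).

Definition somega1 := sd 4 ^^ sd 5 ++ sd 6 ^^ sd 7.
Definition somega2 := sd 4 ^^ sd 6 ++ sd 7 ^^ sd 5.
Definition somega3 := sneg (sd 4 ^^ sd 7 ++ sd 5 ^^ sd 6).
Definition sphi := sd 1 ^^ sd 2 ^^ sd 3 ++
  ((sd 1 ^^ somega1 ++ sd 2 ^^ somega2) ++ sd 3 ^^ somega3).
Definition sone : sform := [:: (1, [::], nseq 7 false)].
Definition spower k l := iter k (swedge 7 l) sone.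

Definition svar v l : sform := [seq (t.1.1, v :: t.1.2, t.2) | t <- l].
(* The variable 3 * a + j stands for the coefficient of dy^(a+4) /\ dx^(j+1). *)
Definition scurv : sform :=
  flatten [seq flatten [seq svar (3 * a + j) (sd (a + 4) ^^ sd j.+1) | a <- iota 0 4]
          | j <- iota 0 3]%N.

Section Interp.
Variables (K : comNzRingType) (x : nat -> K).
Local Notation interp := (interp 7 x).

Lemma interp_sd k : (0 < k <= 7)%N -> interp (sd k) = d_ K k.
Proof.
case: k => // k k7; rewrite /interp big_seq1 /scoef big_nil mulr1 scale1r.
congr (monomial _ _); apply/setP => i; rewrite !inE nth_mkseq //.
by rewrite -val_eqE /= inordK // eq_sym.
Qed.

Lemma interp_sneg l : interp (sneg l) = - interp l.
Proof. by rewrite interp_sscale rmorphN1 scaleN1r. Qed.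

Lemma interp_sphi : interp sphi = phiG2 K.
Proof.
by rewrite /sphi /somega1 /somega2 /somega3
  !(interp_cat, interp_swedge, interp_sneg, interp_sd).
Qed.

Lemma interp_spower k l : interp (spower k l) = wedge_exp (interp l) k.
Proof.
elim: k => [|k IHk]; last by rewrite /spower iterS interp_swedge IHk.
rewrite /interp big_seq1 /scoef big_nil mulr1 scale1r.
by congr (monomial _ _); apply/setP => i; rewrite !inE nth_nseq ltn_ord.
Qed.

Lemma interp_svar v l : interp (svar v l) = x v *: interp l.
Proof.
rewrite /interp big_map scaler_sumr; apply: eq_bigr => t _.
by rewrite scalerA /scoef /= big_cons mulrCA.
Qed.

Lemma interp_flatten_iota n (s : nat -> sform) :
  interp (flatten [seq s i | i <- iota 0 n]) = \sum_(i < n) interp (s i).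
Proof.
rewrite /interp big_flatten big_map -(big_mkord predT (fun i => interp (s i))).
by rewrite /index_iota subn0.
Qed.

Lemma interp_scurv : interp scurv =
  \sum_(j < 3) \sum_(a < 4) x (3 * a + j)%N *: (d_ K (a + 4) \wedge d_ K j.+1).
Proof.
rewrite interp_flatten_iota; apply: eq_bigr => j _.
rewrite interp_flatten_iota; apply: eq_bigr => a _.
rewrite interp_svar interp_swedge !interp_sd //.
  by rewrite ltnS (leq_trans (ltn_ord j)).
by rewrite addnC /= -[7%N]/(4 + 3)%N leq_add2l -ltnS ltn_ord.
Qed.

End Interp.

(** With iF for the curvature, (iF)^3 / 6 + iF /\ *phi = (i / 6) (6 F /\ *phi - F^3). The last
    factor has integer coefficients, so it can be computed symbolically. *)
Definition sdDT := Eval vm_compute in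
  scollect (sscale 6 (scurv ^^ shodge 7 sphi) ++ sneg (spower 3 scurv)).
Definition sdDT' := Eval vm_compute in
  scollect (sphi ^^ shodge 7 (spower 2 scurv)).

Lemma interp_sdDT (K : comNzRingType) (x : nat -> K) (F := interp 7 x scurv) :
  interp 7 x sdDT = 6 *: (F \wedge hodge (phiG2 K)) - wedge_exp F 3.
Proof.
have -> : sdDT = scollect (sscale 6 (scurv ^^ shodge 7 sphi) ++ sneg (spower 3 scurv)).
  by vm_compute.
by rewrite interp_scollect interp_cat interp_sscale interp_swedge interp_shodge
  interp_sphi interp_sneg interp_spower.
Qed.

Lemma interp_sdDT' (K : comNzRingType) (x : nat -> K) (F := interp 7 x scurv) :
  interp 7 x sdDT' = phiG2 K \wedge hodge (wedge_exp F 2).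
Proof.
have -> : sdDT' = scollect (sphi ^^ shodge 7 (spower 2 scurv)) by vm_compute.
by rewrite interp_scollect interp_swedge interp_shodge interp_sphi interp_spower.
Qed.

Section Coefficients.
Variables (K : numFieldType) (x : nat -> K).
Let p a j := x (3 * a + j)%N.

Lemma scoef_at_filter (y : nat -> K) l m :
  scoef_at y l m = \sum_(t <- [seq t <- l | t.2 == m]) scoef y t.
Proof. by rewrite big_filter. Qed.

(** The mask omits position [a + 3], that is dy^(a+4). The linear terms of [defect] come from F /\
    *phi and its 3 x 3 minor from F^3. *)
Lemma scoef_sdDT a : (a < 4)%N ->
  scoef_at x sdDT (mkseq (fun i => i != a + 3)%N 7) = - 6 * defect p a.
Proof.
(* Computation selects the terms with the given mask and leaves a polynomial identity. *)
case: a => [|[|[|[|//]]]] _; rewrite scoef_at_filter;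
  set l := filter _ _; vm_compute in l; rewrite {}/l;
  rewrite !big_cons big_nil /scoef !big_cons !big_nil /p
    /defect /minor3 /minor2 /=; ring.
Qed.

Lemma scoef_sdDT' j : (j < 3)%N ->
  scoef_at x sdDT' (mkseq (fun i => i != j)%N 7)
  = (-1) ^+ j.+1 * 2 * defect_comb p j.
Proof.
case: j => [|[|[|//]]] _; rewrite scoef_at_filter;
  set l := filter _ _; vm_compute in l; rewrite {}/l;
  rewrite !big_cons big_nil /scoef !big_cons !big_nil /p
    /defect_comb /defect /minor3 /minor2 /=; ring.
Qed.

(** Only the four masks omitting a single dy occur in [sdDT], and 6 is nonzero in a
    [numFieldType]. *)
Lemma sdDT_eq0 :
  interp 7 x sdDT = 0 <-> forall a, (a < 4)%N -> defect p a = 0.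
Proof.
rewrite interp_eq0 //.
have msE : undup [seq t.2 | t <- sdDT] =i
    [seq mkseq (fun i => i != a + 3)%N 7 | a <- iota 0 4].
  by apply: perm_mem; vm_compute.
split=> [h a a4|h m].
  have /eqP : scoef_at x sdDT (mkseq (fun i => i != a + 3)%N 7) = 0.
    by apply: h; rewrite msE; apply/mapP; exists a; rewrite ?mem_iota.
  by rewrite scoef_sdDT // mulf_eq0 oppr_eq0 pnatr_eq0 => /eqP.
rewrite msE => /mapP[a]; rewrite mem_iota => a4 ->.
by rewrite scoef_sdDT // h // mulr0.
Qed.

Lemma sdDT'_eq0 : (forall a, (a < 4)%N -> defect p a = 0) -> interp 7 x sdDT' = 0.
Proof.
move=> h; apply/interp_eq0 => //.
have msE : undup [seq t.2 | t <- sdDT'] =i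
    [seq mkseq (fun i => i != j)%N 7 | j <- iota 0 3].
  by apply: perm_mem; vm_compute.
move=> m; rewrite msE => /mapP[j]; rewrite mem_iota => j3 ->.
by rewrite scoef_sdDT' // /defect_comb !h // !mulr0 !subr0 addr0 mulr0.
Qed.

End Coefficients.

(** * Evaluation of forms on tangent vectors *)

Section FormEval.
Variables (K : comNzRingType) (k n : nat).
Implicit Types (a b : Defs.form K n) (M : 'M[K]_(k, n)) (s : {ffun 'I_k -> 'I_n}).

Lemma form_evalD a b M : form_eval (a + b) M = form_eval a M + form_eval b M.
Proof. by rewrite -big_split; apply: eq_bigr => s _; rewrite !ffunE mulrDl. Qed.

Lemma form_evalZ c a M : form_eval (c *: a) M = c * form_eval a M.
Proof. by rewrite mulr_sumr; apply: eq_bigr => s _; rewrite !ffunE mulrA. Qed.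

Lemma form_eval_mul a (A : 'M_k) M : form_eval a (A *m M) = \det A * form_eval a M.
Proof.
rewrite mulr_sumr; apply: eq_bigr => s _.
by rewrite mulrCA -det_mulmx mulmx_colsub.
Qed.

Definition increasing s := forall i j : 'I_k, (i < j)%N -> (s i < s j)%N.

(** The values of an increasing map form a strictly sorted list, which is determined by its
    elements. *)
Lemma increasing_inj s t : increasing s -> increasing t ->
  [set s i | i in 'I_k] = [set t i | i in 'I_k] -> s = t.
Proof.
have s_sorted (u : {ffun 'I_k -> 'I_n}) : increasing u ->
    sorted ltn [seq val (u i : 'I_n) | i : 'I_k].
  move=> u_incr; apply: (homo_sorted (e := relpre val ltn)) => //.
  by rewrite -sorted_map val_enum_ord iota_ltn_sorted.
move=> /s_sorted ss /s_sorted st st_im.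
have st_val : [seq val (s i) | i : 'I_k] = [seq val (t i) | i : 'I_k].
  apply: (irr_sorted_eq ltn_trans ltnn ss st) => v.
  have imE (u : {ffun 'I_k -> 'I_n}) :
      (v \in [seq val (u i) | i : 'I_k]) =
      [exists w in [set u i | i in 'I_k], v == val w].
    apply/mapP/exists_inP => [[i _ ->]|[w /imsetP[i _ ->] /eqP ->]].
      by exists (u i); rewrite ?imset_f.
    by exists i; rewrite ?mem_enum.
  by rewrite !imE st_im.
apply/ffunP => i; apply: val_inj.
have /eq_in_map/(_ i) := st_val; apply; exact: mem_enum.
Qed.

Lemma form_eval_monomial s M : increasing s ->
  form_eval (monomial K [set s i | i in 'I_k]) M = \det (colsub s M).
Proof.
move=> s_incr; rewrite /form_eval (bigD1 s) /=; last first.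
  by apply/'forall_forallP => i j; apply/implyP/s_incr.
rewrite ffunE eqxx mul1r big1 ?addr0 // => t /andP[/'forall_forallP t_incr ts].
rewrite ffunE; case: eqP => [st|]; last by rewrite mul0r.
case/eqP: ts; apply: increasing_inj => // i j; exact/implyP/t_incr.
Qed.

End FormEval.

Definition positions (m : seq bool) := [seq i <- iota 0 (size m) | nth false m i].

(** The only increasing map whose image is the set of [m] enumerates the true positions of [m], so a
    single minor with explicit columns survives. *)
Lemma form_eval_mask (K : comNzRingType) k n m (F : nat -> nat -> K) :
  size m = n.+1 -> size (positions m) = k ->
  form_eval (monomial K (mask_set n.+1 m)) (\matrix_(i < k, j < n.+1) F i j)
  = laplace k (fun i j => F i (nth 0%N (positions m) j)).
Proof.
move=> sm sk.
have pos_lt j : (j < k)%N -> (nth 0%N (positions m) j < n.+1)%N.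
  rewrite -sk => /(mem_nth 0%N); rewrite mem_filter mem_iota sm => /andP[_]; exact.
pose s := [ffun j : 'I_k => inord (nth 0%N (positions m) j) : 'I_n.+1].
have s_val j : s j = nth 0%N (positions m) j :> nat.
  by rewrite ffunE inordK // pos_lt.
have s_incr : increasing s.
  move=> i j ij; rewrite !s_val; 
  have pos_sorted : sorted ltn (positions m).
    exact/(sorted_filter ltn_trans)/iota_ltn_sorted.
  have := sorted_ltn_nth ltn_trans 0%N pos_sorted.
  by move=> /(_ i j); rewrite !inE sk !ltn_ord; apply.
have -> : mask_set n.+1 m = [set s j | j in 'I_k].
  apply/setP => i; rewrite inE; apply/idP/imsetP => [mi|[j _ ->]].
    have im : val i \in positions m by rewrite mem_filter mi mem_iota sm ltn_ord.
    rewrite -index_mem sk in im; exists (Ordinal im) => //.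
    by apply: val_inj; rewrite /= s_val /= nth_index // -index_mem sk.
  have : nth 0%N (positions m) j \in positions m by apply: mem_nth; rewrite sk.
  by rewrite mem_filter -s_val => /andP[].
rewrite form_eval_monomial // -det_laplace; congr (\det _).
by apply/matrixP => i j; rewrite !mxE s_val.
Qed.

Definition sstar := Eval vm_compute in scollect (shodge 7 sphi).

(** Column [i >= 3] belongs to y^(i+1), whence the offset 3 in the identity block. *)
Definition graph_entry (K : comNzRingType) (p : nat -> nat -> K) (a i : nat) : K :=
  if (i < 3)%N then p a i else ((a + 3)%N == i)%:R.

Lemma form_eval_star (K : comNzRingType) (p : nat -> nat -> K) :
  form_eval (hodge (phiG2 K)) (\matrix_(a < 4, i < 7) graph_entry p a i)
  = star_eval p.
Proof.
(* No variable occurs in [sphi], so any assignment will do. *)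
pose x (v : nat) : K := 0.
have <- : interp 7 x sstar = hodge (phiG2 K).
  rewrite -(interp_sphi x) -interp_shodge -[RHS]interp_scollect.
  by have -> : scollect (shodge 7 sphi) = sstar by vm_compute.
rewrite /interp /sstar !big_cons big_nil addr0 !form_evalD !form_evalZ.
rewrite /scoef /= !big_nil !(@form_eval_mask _ 4 6) //.
by rewrite /laplace /bump /= /graph_entry /star_eval /minor2 /=; ring.
Qed.

Definition entries (R : Type) (P : 'M[R]_(4, 3)) (a j : nat) : R :=
  P (inord a) (inord j).

Definition graph_mx (R : comNzRingType) (P : 'M[R]_(4, 3)) : 'M[R]_(4, 3 + 4) :=
  row_mx P 1%:M.

Lemma graph_mxE (R : comNzRingType) (P : 'M[R]_(4, 3)) :
  graph_mx P = \matrix_(a < 4, i < 7) graph_entry (entries P) a i.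
Proof.
apply/matrixP => a i; rewrite !mxE /graph_entry.
case: splitP => j ij; rewrite ij ?ltn_ord.
  by rewrite /entries !inord_val.
by rewrite ltnNge leq_addr /= mxE addnC eqn_add2l val_eqE.
Qed.

Lemma form_eval_graph (R : comNzRingType) (P : 'M[R]_(4, 3)) :
  form_eval (hodge (phiG2 R)) (graph_mx P) = star_eval (entries P).
Proof. by rewrite graph_mxE form_eval_star. Qed.

Lemma gram_graph (R : comNzRingType) (P : 'M[R]_(4, 3)) :
  \det (graph_mx P *m (graph_mx P)^T) = laplace 4 (gram (entries P)).
Proof.
rewrite -det_laplace; congr (\det _); apply/matrixP => a b.
rewrite tr_row_mx mul_row_col trmx1 mulmx1 !mxE /gram.
rewrite !big_ord_recr big_ord0 /= add0r !mxE /entries !inord_val.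
by congr (P _ _ * P _ _ + P _ _ * P _ _ + P _ _ * P _ _ + _);
  apply: val_inj; rewrite /= inordK.
Qed.

(** The determinant is a sum of squares by [laplace_gram]. It is nonzero because a row vector v in
    the kernel of the Gram matrix satisfies |vP|^2 + |v|^2 = 0. *)
Lemma det_gram_graph_gt0 (R : realFieldType) (P : 'M[R]_(4, 3)) :
  0 < \det (graph_mx P *m (graph_mx P)^T).
Proof.
rewrite lt_def; apply/andP; split; last first.
  by rewrite gram_graph laplace_gram !addr_ge0 ?sqr_ge0.
rewrite -unitfE -unitmxE -row_free_unit; apply: inj_row_free => v vN0.
have : ((v *m graph_mx P) *m (v *m graph_mx P)^T) 0 0 = 0.
  by rewrite trmx_mul mulmxA -(mulmxA v) vN0 mul0mx mxE.
rewrite mul_mx_row mulmx1 tr_row_mx mul_row_col mxE => /eqP.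
have sq_ge0 m (w : 'rV[R]_m) : 0 <= (w *m w^T) 0 0.
  by rewrite mxE sumr_ge0 // => i _; rewrite mxE -expr2 sqr_ge0.
rewrite paddr_eq0 // => /andP[_]; rewrite mxE psumr_eq0 => [/allP v0|i _].
  apply/rowP => i; have := v0 i (mem_index_enum i).
  by rewrite !mxE -expr2 sqrf_eq0 => /eqP.
by rewrite mxE -expr2 sqr_ge0.
Qed.

(** By [laplace_gram] the two sides differ by a sum of squares that includes those of all defects;
    the remaining squares are of linear combinations of defects. *)
Lemma calibrated_graph (R : realFieldType) (P : 'M[R]_(4, 3)) :
  form_eval (hodge (phiG2 R)) (graph_mx P) ^+ 2
    = \det (graph_mx P *m (graph_mx P)^T)
  <-> forall a, (a < 4)%N -> defect (entries P) a = 0.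
Proof.
rewrite form_eval_graph gram_graph laplace_gram; split=> [|h].
  rewrite -addrA -[LHS]addr0 => /addrI/esym/eqP.
  rewrite paddr_eq0 ?addr_ge0 ?sqr_ge0 // => /andP[+ _].
  rewrite !paddr_eq0 ?addr_ge0 ?sqr_ge0 // !sqrf_eq0.
  by case/andP=> /andP[/andP[/eqP ? /eqP ?] /eqP ?] /eqP ? [|[|[|[|]]]].
by rewrite /defect_comb !h // !mulr0 !subr0 !addr0 expr0n !addr0.
Qed.

(** A change of basis M multiplies the value of *phi by det M and the volume by |det M|. Squaring
    reduces to [calibrated_graph]; the sign is what squaring loses. *)
Lemma calibrated_mulmx_graph (R : rcfType) (M : 'M[R]_4) (P : 'M[R]_(4, 3)) :
  M \in unitmx ->
  form_eval (hodge (phiG2 R)) (M *m graph_mx P)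
    = Num.sqrt (\det ((M *m graph_mx P) *m (M *m graph_mx P)^T))
  <-> 0 < \det M * form_eval (hodge (phiG2 R)) (graph_mx P)
      /\ forall a, (a < 4)%N -> defect (entries P) a = 0.
Proof.
rewrite unitmxE unitfE => M0; rewrite form_eval_mul.
have -> : \det ((M *m graph_mx P) *m (M *m graph_mx P)^T)
    = \det M ^+ 2 * \det (graph_mx P *m (graph_mx P)^T).
  by rewrite trmx_mul mulmxA -(mulmxA M) !det_mulmx det_tr mulrAC expr2.
have gram_gt0 := det_gram_graph_gt0 P; rewrite -calibrated_graph.
set c := form_eval _ _; set G := \det (graph_mx _ *m _) in gram_gt0 *.
have M2 : 0 < \det M ^+ 2 by rewrite exprn_even_gt0.
split=> [Mc|[Mc_gt0 cG]]; last by rewrite -cG -exprMn sqrtr_sqr gtr0_norm.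
  split; first by rewrite Mc sqrtr_gt0 mulr_gt0.
  apply: (mulfI (lt0r_neq0 M2)).
  by rewrite -exprMn Mc sqr_sqrtr // mulr_ge0 // ltW.
Qed.

Lemma row_free_graph_mx (R : fieldType) (P : 'M[R]_(4, 3)) : row_free (graph_mx P).
Proof.
apply/row_freeP; exists (col_mx 0 1%:M).
by rewrite mul_row_col mulmx0 add0r mulmx1.
Qed.

Lemma row_free_mull (R : fieldType) m n (A : 'M[R]_m) (N : 'M[R]_(m, n)) :
  row_free N -> row_free (A *m N) = (A \in unitmx).
Proof.
by move=> fN; rewrite -row_free_unit /row_free mxrankMfree.
Qed.

(** Swapping two coordinates reverses the orientation; this is how a parametrization of the graph is
    made positive for *phi. *)
Lemma exists_det_sign (R : realFieldType) (c : R) : c != 0 ->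
  exists T : 'M[R]_4, 0 < \det T * c.
Proof.
rewrite neq_lt => /orP[c0|c0]; last by exists 1%:M; rewrite det1 mul1r.
exists (perm_mx (tperm 0 1)).
by rewrite det_perm odd_tperm /= expr1 mulN1r oppr_gt0.
Qed.

Lemma defect_rmorph (R S : comNzRingType) (g : {rmorphism R -> S})
    (p : nat -> nat -> R) a :
  defect (fun i j => g (p i j)) a = g (defect p a).
Proof.
by case: a => [|[|[|[|a]]]]; rewrite /defect /minor3 /minor2 /= ?nth_nil
  !(rmorph0, rmorphD, rmorphN, rmorphM).
Qed.

Lemma defect_ext (R : comNzRingType) (p q : nat -> nat -> R) a :
  (forall i j, (j < 3)%N -> p i j = q i j) -> defect p a = defect q a.
Proof. by move=> pq; rewrite /defect /minor3 /minor2 !pq. Qed.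

(** * The dDT equation in terms of the defects *)

Section DDT.
Variables (R : rcfType) (P : 'M[R]_(4, 3)).
Let F : Defs.form R[i] 7 := 'i%C *: \sum_(j < 3) \sum_(a < 4)
    (P a j)%:C%C *: (d_ R[i] (a + 4) \wedge d_ R[i] j.+1).
(** Decodes the variable [3 * a + j] of [scurv] by quotient and remainder, and embeds the real entry
    into [R[i]]. *)
Let x (v : nat) := (entries P (v %/ 3) (v %% 3))%:C%C.

Let F_interp : F = 'i%C *: interp 7 x scurv.
Proof.
rewrite interp_scurv; congr (_ *: _).
apply: eq_bigr => j _; apply: eq_bigr => a _; congr (_ *: _).
rewrite /x mulnC divnMDl // divn_small // addn0 modnMDl modn_small //.
by rewrite /entries !inord_val.
Qed.

Let defect_x : (forall a, (a < 4)%N -> defect (fun a j => x (3 * a + j)%N) a = 0) <->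
  (forall a, (a < 4)%N -> defect (entries P) a = 0).
Proof.
have E a : defect (fun a j => x (3 * a + j)%N) a = (defect (entries P) a)%:C%C.
  rewrite -[RHS]defect_rmorph; apply: defect_ext => i j j3.
  by rewrite /x mulnC divnMDl // divn_small // addn0 modnMDl modn_small.
split=> h a a4; last by rewrite E h.
by have /eqP := h a a4; rewrite E (fmorph_eq0 (real_complex R)) => /eqP.
Qed.

Lemma dDT_defect : 6^-1 *: wedge_exp F 3 + F \wedge hodge (phiG2 R[i]) = 0 <->
  forall a, (a < 4)%N -> defect (entries P) a = 0.
Proof.
rewrite -defect_x -sdDT_eq0 interp_sdDT F_interp wedge_expZ wedgeZl.
set A := wedge_exp _ _; set C := _ \wedge _.
have i0 : 'i%C != 0 :> R[i] by rewrite neq0Ci.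
(* Since i^3 = -i, the constant i / 6 factors out. *)
have -> : 6^-1 *: ('i%C ^+ 3 *: A) + 'i%C *: C
    = ('i%C / 6) *: (6 *: C - A) :> Defs.form R[i] 7.
  rewrite scalerBr !scalerA exprS sqrCi mulrN1 mulrN scaleNr addrC mulrC.
  by rewrite divfK ?pnatr_eq0.
split=> [/eqP|->]; last exact: scaler0.
by rewrite scaler_eq0 mulf_eq0 (negPf i0) invr_eq0 pnatr_eq0 => /eqP.
Qed.

Lemma defect_dDT' : (forall a, (a < 4)%N -> defect (entries P) a = 0) ->
  phiG2 R[i] \wedge hodge (wedge_exp F 2) = 0.
Proof.
move/defect_x/sdDT'_eq0; rewrite interp_sdDT' F_interp wedge_expZ hodgeZ wedgeZr.
by move=> ->; rewrite scaler0.
Qed.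

End DDT.

From mathcomp Require Import all_classical all_reals all_analysis.

Import numFieldNormedType.Exports.

Local Open Scope classical_set_scope.
Local Open Scope ring_scope.

(** * Smooth maps and lifts to R^3 *)

Section Differentiability.
Variables (R : realType).

(** Write g = f - (f - g): the map f - g vanishes near x, so the zero map satisfies the defining
    expansion of its differential. *)
Lemma near_eq_differentiable (V W : normedModType R) (f g : V -> W) x :
  (\near x, f x = g x) -> differentiable f x -> differentiable g x.
Proof.
move=> fg df.
have h0 : \near x, (f - g) x = 0.
  by near=> z; rewrite !fctE; apply/eqP; rewrite subr_eq0; apply/eqP; near: z.
rewrite (_ : g = f - (f - g)); last by apply/funext => z /=; rewrite !fctE subKr.
apply: differentiableB => //; move: (f - g) h0 => {fg df f g} h h0.
have hx := nbhs_singleton h0.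
have dh0 : h \o shift x = cst (h x) + (\0 : {linear V -> W}) +o_ 0 id.
  apply/eqaddoP => e e0.
  rewrite [\forall x \near _, _ <= _](near_shift x).
  apply: filterS h0 => z hz; rewrite /= !fctE /shift /= sub0r subrK hz hx.
  by rewrite addr0 subr0 normr0 mulr_ge0 // ltW.
have c0 : continuous (\0 : {linear V -> W}) by move=> ?; exact: cvg_cst.
apply/diff_locallyP; rewrite (diff_unique c0 dh0); split => //.
Unshelve. all: by end_near. Qed.

Lemma linear_rV_continuous n (V : normedModType R) (f : {linear 'rV[R]_n -> V}) :
  continuous f.
Proof.
have fE (x : 'rV_n) : f x = \sum_(i < n) x 0 i *: f (delta_mx 0 i).
  rewrite {1}(row_sum_delta x) linear_sum.
  by apply: eq_bigr => i _; rewrite linearZ.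
rewrite (_ : (f : _ -> _) = fun x => \sum_(i < n) x 0 i *: f (delta_mx 0 i));
  last exact/funext.
apply: continuous_big => [|i _ x]; first exact: add_continuous.
by apply: (@cvgZr_tmp _ _ _ (nbhs x)); exact: coord_continuous.
Qed.

Lemma differentiable_mulmxr m n (A : 'M[R]_(m, n)) (u : 'rV_m) :
  differentiable (fun v : 'rV_m => v *m A) u.
Proof.
apply: (@linear_differentiable _ _ _ (mulmxr A : {linear 'rV_m -> 'rV_n})).
exact: linear_rV_continuous.
Qed.

Lemma jacobian_mulmxr m n (A : 'M[R]_(m, n)) (u : 'rV_m) :
  'J (fun v : 'rV_m => v *m A) u = A.
Proof.
apply/row_matrixP => i; rewrite !rowE mul_rV_lin1.
rewrite (@diff_lin _ _ _ (mulmxr A : {linear 'rV_m -> 'rV_n})) //.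
exact: linear_rV_continuous.
Qed.

Lemma jacobian_comp m n p (g : 'rV[R]_m -> 'rV[R]_n) (h : 'rV[R]_n -> 'rV[R]_p) u :
  differentiable g u -> differentiable h (g u) ->
  'J (h \o g) u = 'J g u *m 'J h (g u).
Proof.
move=> dg dh; apply/row_matrixP => i.
by rewrite !rowE mulmxA !mul_rV_lin1 diff_comp.
Qed.

Lemma jacobian_rsubmx m n1 n2 (g : 'rV[R]_m -> 'rV[R]_(n1 + n2)) u :
  differentiable g u -> 'J (rsubmx \o g) u = rsubmx ('J g u).
Proof.
move=> dg.
have E k (M : 'M[R]_(k, n1 + n2)) : rsubmx M = M *m col_mx 0 1%:M.
  by rewrite -[in RHS](hsubmxK M) mul_row_col mulmx0 add0r mulmx1.
rewrite E (_ : rsubmx = fun v : 'rV[R]_(n1 + n2) => v *m col_mx 0 1%:M);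
  last exact/funext.
by rewrite jacobian_comp ?jacobian_mulmxr //; exact: differentiable_mulmxr.
Qed.

Lemma jacobian_lsubmx m n1 n2 (g : 'rV[R]_m -> 'rV[R]_(n1 + n2)) u :
  differentiable g u -> 'J (lsubmx \o g) u = lsubmx ('J g u).
Proof.
move=> dg.
have E k (M : 'M[R]_(k, n1 + n2)) : lsubmx M = M *m col_mx 1%:M 0.
  by rewrite -[in RHS](hsubmxK M) mul_row_col mulmx0 addr0 mulmx1.
rewrite E (_ : lsubmx = fun v : 'rV[R]_(n1 + n2) => v *m col_mx 1%:M 0);
  last exact/funext.
by rewrite jacobian_comp ?jacobian_mulmxr //; exact: differentiable_mulmxr.
Qed.

Lemma jacobian_derive m n (g : 'rV[R]_m -> 'rV[R]_n) u i j :
  differentiable g u -> 'J g u i j = ('D_(delta_mx 0 i) g u) 0 j.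
Proof. by move=> dg; rewrite mxE deriveE. Qed.

Lemma near_eq_jacobian m n (g h : 'rV[R]_m -> 'rV[R]_n) u :
  (\near u, g u = h u) -> differentiable g u -> 'J g u = 'J h u.
Proof.
move=> gh dg; have dh := near_eq_differentiable gh dg.
apply/matrixP => i j; rewrite [LHS](jacobian_derive i j dg) [RHS](jacobian_derive i j dh).
exact: (congr1 (fun M : 'rV_n => M 0 j) (near_eq_derive _ gh)).
Qed.

Lemma jacobianD_cst m n (g : 'rV[R]_m -> 'rV[R]_n) (c : 'rV_n) u :
  differentiable g u -> 'J (fun z => g z + c) u = 'J g u.
Proof.
move=> dg; have dc : differentiable (cst c) u by exact: differentiable_cst.
have dgc : differentiable (g + cst c) u by exact: differentiableD.
apply/matrixP => i j.
rewrite [LHS](jacobian_derive i j dgc) [RHS](jacobian_derive i j dg).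
rewrite (deriveD (diff_derivable dg) (diff_derivable dc)) [X in _ + X]derive_cst.
by rewrite addr0.
Qed.

End Differentiability.

Section Smooth.
Variable R : realType.
Implicit Types V W : normedModType R.

(** On an open set, equality at each point is equality near each point, which passes to directional
    derivatives and so feeds the induction. *)
Lemma eq_Ck_on V W k (U : set V) (g h : V -> W) : open U ->
  (forall u, U u -> g u = h u) -> Ck_on k U g -> Ck_on k U h.
Proof.
move=> oU; elim: k g h => [|k IHk] g h gh.
  move=> cg u Uu; have : (\near u, g u = h u).
    by apply: filterS (open_nbhs_nbhs (conj oU Uu)).
  move=> gh_u; apply: (@cvg_trans _ (g @ u)); first exact: near_eq_cvg.
  by have := cg u Uu; rewrite /prop_for /continuous_at gh.
have gh_u u : U u -> \near u, g u = h u.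
  by move=> Uu; apply: filterS (open_nbhs_nbhs (conj oU Uu)).
move=> [dg Dg]; split=> [u Uu|v].
  exact: near_eq_differentiable (gh_u _ Uu) (dg _ Uu).
by apply: IHk (Dg v) => u /gh_u; exact: near_eq_derive.
Qed.

Lemma Ck_on_cst V W k (U : set V) (c : W) : Ck_on k U (fun=> c).
Proof.
elim: k c => [|k IHk] c; first by move=> u _; exact: cvg_cst.
split=> [u _|v]; first exact: differentiable_cst.
have -> : (fun u => 'D_v (fun=> c) u) = fun=> 0 by apply/funext => u; exact: derive_cst.
exact: IHk.
Qed.

Lemma Ck_on_linear V W k (U : set V) (f : {linear V -> W}) : continuous f ->
  Ck_on k U f.
Proof.
move=> cf; case: k => [|k]; first by move=> u _; exact: cf.
split=> [u _|v]; first exact: linear_differentiable.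
suff -> : (fun u => 'D_v f u) = fun=> f v by exact: Ck_on_cst.
by apply/funext => u; rewrite deriveE ?diff_lin //; exact: linear_differentiable.
Qed.

Lemma Ck_onD V W k (U : set V) (g h : V -> W) : open U ->
  Ck_on k U g -> Ck_on k U h -> Ck_on k U (g + h).
Proof.
move=> oU; elim: k g h => [|k IHk] g h.
  by move=> cg ch u Uu; apply: cvgD; [exact: cg|exact: ch].
move=> [dg Dg] [dh Dh]; split=> [u Uu|v].
  by apply: differentiableD; [exact: dg|exact: dh].
apply: eq_Ck_on (IHk _ _ (Dg v) (Dh v)) => // u Uu.
by rewrite deriveD //; apply: diff_derivable; [exact: dg|exact: dh].
Qed.

Lemma Ck_on_post V W W' k (U : set V) (g : V -> W) (f : {linear W -> W'}) :
  open U -> continuous f -> Ck_on k U g -> Ck_on k U (f \o g).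
Proof.
move=> oU cf; have df w : differentiable f w by exact: linear_differentiable.
elim: k g => [|k IHk] g.
  by move=> cg u Uu; apply: continuous_comp; [exact: cg|exact: cf].
move=> [dg Dg]; split=> [u Uu|v].
  by apply: differentiable_comp => //; exact: dg.
apply: eq_Ck_on (IHk _ (Dg v)) => // u Uu; have dgu := dg u Uu.
have dfg : differentiable (f \o g) u by exact: differentiable_comp.
rewrite [RHS](deriveE _ dfg) [RHS](_ : _ = f ('d g u v)).
  by congr (f _); exact: deriveE.
by rewrite (diff_comp dgu (df _)) /= diff_lin.
Qed.

Lemma Ck_on_pre V V' W k (U : set V) (g : V -> W) (f : {linear V' -> V}) :
  continuous f -> Ck_on k U g -> Ck_on k (f @^-1` U) (g \o f).
Proof.
move=> cf; have df w : differentiable f w by exact: linear_differentiable.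
elim: k g => [|k IHk] g.
  by move=> cg u Uu; apply: continuous_comp; [exact: cf|exact: cg].
move=> [dg Dg]; split=> [u Uu|v].
  by apply: differentiable_comp => //; exact: dg.
(* The difference quotients themselves coincide by linearity of [f], so this holds at every point,
   inside [U] or not. *)
suff -> : (fun u => 'D_v (g \o f) u) = ('D_(f v) g) \o f by exact: IHk (Dg _).
apply/funext => u /=; rewrite /derive; congr (lim _).
apply: (congr1 (fun k => fmap k _)); apply/funext => h.
by rewrite /= linearP.
Qed.

Lemma Ck_on_subset V W k (U U' : set V) (g : V -> W) :
  U' `<=` U -> Ck_on k U g -> Ck_on k U' g.
Proof.
move=> sU; elim: k g => [|k IHk] g; first by move=> cg u /sU; exact: cg.
by move=> [dg Dg]; split=> [u /sU|v]; [exact: dg|exact: IHk (Dg v)].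
Qed.

Lemma smooth_on_differentiable V W (U : set V) (g : V -> W) u :
  smooth_on U g -> U u -> differentiable g u.
Proof. by move=> /(_ 1) [+ _]; apply. Qed.

End Smooth.

Lemma to_torus_eq (R : realType) (u v : 'rV[R]_3) : to_torus u = to_torus v ->
  exists k : 'rV[int]_3, u - v = (2 * pi) *: map_mx intr k.
Proof. by move=> /eqquotP/asboolP. Qed.

(** The difference of the lifts is continuous with values in the discrete lattice (2 pi Z)^3, hence
    locally constant. *)
Lemma torus_lift_unique (R : realType) (V : normedModType R)
    (g h : V -> 'rV[R]_3) (u : V) :
  {for u, continuous g} -> {for u, continuous h} ->
  (\forall z \near u, to_torus (g z) = to_torus (h z)) ->
  \forall z \near u, g z = h z + (g u - h u).
Proof.
move=> cg ch gh.
have cd : (g - h) @ u --> g u - h u by exact: cvgB.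
have [k0 k0E] := to_torus_eq (nbhs_singleton gh).
have pi2 : 0 < 2 * pi :> R by rewrite mulr_gt0 ?pi_gt0.
near=> z.
have gz : to_torus (g z) = to_torus (h z) by near: z.
have [k kE] := to_torus_eq gz.
(* Lattice points whose coordinates differ by less than 2 pi coincide, since an integer of absolute
   value below 1 is zero. *)
have : ball (g u - h u) (2 * pi) ((g - h) z).
  by near: z; apply: cd; exact: nbhsx_ballx.
move=> [_ dz].
suff kk0 : k = k0 by rewrite k0E -kk0 -kE addrC subrK.
apply/rowP => j; have := dz 0 j.
rewrite k0E !fctE kE -ball_normE /ball_ /= !mxE -mulrBr normrM gtr0_norm //.
rewrite gtr_pMr // -rmorphB -intr_norm ltrz1 => kk0.
by apply/esym/eqP; rewrite -subr_eq0 -normr_le0 -ltzD1.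
Unshelve. all: by end_near. Qed.

Lemma near_eq_cvg_to (T U : topologicalType) (g h : T -> U) (x : T) (l : U) :
  (\forall z \near x, g z = h z) -> g @ x --> l -> h @ x --> l.
Proof.
move=> gh; apply: cvg_trans; apply: near_eq_cvg.
by apply: filterS gh => z.
Qed.

Lemma open_preimage_mulmxr (R : realType) m n (T : 'M[R]_(m, n)) (U : set 'rV_n) :
  open U -> open [set z : 'rV_m | U (z *m T)].
Proof.
pose mulT : {linear 'rV[R]_m -> 'rV[R]_n} := mulmxr T.
move=> oU; apply: (@open_comp _ _ mulT) => // z _.
exact: linear_rV_continuous.
Qed.

Lemma star_eval_cvg (R : realType) (T : Type) (F : set_system T) (FF : Filter F)
    (q : T -> nat -> nat -> R) (q0 : nat -> nat -> R) :
  (forall i j, q x i j @[x --> F] --> q0 i j) ->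
  star_eval (q x) @[x --> F] --> star_eval q0.
Proof.
move=> qq0.
have m2 a b i j : minor2 (q x) a b i j @[x --> F] --> minor2 q0 a b i j.
  by apply: cvgB; apply: cvgM; exact: qq0.
by do 3!apply: (cvgB _ (m2 _ _ _ _)); do 3!apply: (cvgD _ (m2 _ _ _ _)); exact: cvg_cst.
Qed.

(** * Parametrizations by graphs of lifts *)

Section Parametrization.
Variables (R : realType) (L : 'rV[R]_4 -> 'rV[R]_3) (T : 'M[R]_4).

(** The linear change of variables [T] serves to adjust the orientation. *)
Definition graph_param (z : 'rV[R]_4) : 'rV[R]_(3 + 4) := row_mx (L (z *m T)) (z *m T).

Lemma smooth_graph_param (U : set 'rV[R]_4) :
  open U -> smooth_on U L -> smooth_on [set z | U (z *m T)] graph_param.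
Proof.
move=> oU sL k.
pose mulT : {linear 'rV[R]_4 -> 'rV[R]_4} := mulmxr T.
pose inL : {linear 'rV[R]_3 -> 'rV[R]_(3 + 4)} := mulmxr (row_mx 1%:M 0).
pose inR : {linear 'rV[R]_4 -> 'rV[R]_(3 + 4)} := mulmxr (T *m row_mx 0 1%:M).
(* This decomposition involves only sums and compositions with linear maps, so that no general chain
   rule for [Ck_on] is called for. *)
have -> : graph_param = (inL \o (L \o mulT)) + inR.
  apply/funext => z; rewrite /graph_param fctE /= mulmxA !mul_mx_row.
  by rewrite !mulmx1 !mulmx0 add_row_mx addr0 add0r.
have oUT : open (mulT @^-1` U) by exact: open_preimage_mulmxr.
apply: Ck_onD => //; last exact/Ck_on_linear/linear_rV_continuous.
apply: Ck_on_post => //; first exact: linear_rV_continuous.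
by apply: Ck_on_pre; [exact: linear_rV_continuous|exact: sL].
Qed.

Lemma jacobian_graph_param u : differentiable graph_param u ->
  differentiable L (u *m T) -> 'J graph_param u = T *m graph_mx ('J L (u *m T)).
Proof.
move=> dg dL; have dT := differentiable_mulmxr T u.
rewrite mul_mx_row mulmx1 -[LHS]hsubmxK -(jacobian_lsubmx dg) -(jacobian_rsubmx dg).
have -> : lsubmx \o graph_param = L \o (fun z => z *m T).
  by apply/funext => z; exact: row_mxKl.
have -> : rsubmx \o graph_param = fun z => z *m T.
  by apply/funext => z; exact: row_mxKr.
by rewrite (jacobian_comp dT dL) jacobian_mulmxr.
Qed.

End Parametrization.

(** * Coassociativity of the graph in terms of the defects *)

Section Graph.
Variables (R : realType) (B : set 'rV[R]_4) (f : 'rV[R]_4 -> torus3 R).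
Hypothesis smoothf : smooth_to_torus B f.

Definition torus_derivative (y : 'rV[R]_4) : 'M[R]_(4, 3) :=
  \matrix_(a, j) partial_torus B f y j a.

Let P := torus_derivative.
Let S := torus_graph B f.

Lemma torus_graphE p : torus_graph B f p -> B p.1 /\ f p.1 = p.2.
Proof. by move=> [y By <-]. Qed.

(* Any parametrization of the graph factors through the graph of each local lift,
   since two lifts differ by a locally constant element of (2 pi Z)^3. *)
Lemma jacobian_torus_graph (g : 'rV[R]_4 -> 'rV[R]_(3 + 4)) u :
  differentiable g u -> (\forall z \near u, torus_graph B f (Defs.cover (g z))) ->
  'J g u = rsubmx ('J g u) *m graph_mx (torus_derivative (rsubmx (g u))).
Proof.
move=> dg Sg; set y := rsubmx (g u).
have /torus_graphE[By _] := nbhs_singleton Sg.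
pose L := xget (fun=> 0) (local_lift B f y).
have [U [oU Uy UB sL Lf]] : local_lift B f y L by apply: xgetPex; exact: smoothf.
have dL := smooth_on_differentiable sL Uy.
have dr : differentiable (rsubmx \o g) u.
  by apply: differentiable_comp => //; exact: differentiable_rsubmx.
have dl : differentiable (lsubmx \o g) u.
  by apply: differentiable_comp => //; exact: differentiable_lsubmx.
have dLr : differentiable (L \o (rsubmx \o g)) u by exact: differentiable_comp.
have JL : 'J L y = torus_derivative y.
  by apply/matrixP => a j; rewrite jacobian_derive // mxE.
have Ug : \forall z \near u, U (rsubmx (g z)).
  have := differentiable_continuous dr; apply.
  exact: open_nbhs_nbhs.
have lr : \forall z \near u, (lsubmx \o g) z
    = (L \o (rsubmx \o g)) z + ((lsubmx \o g) u - (L \o (rsubmx \o g)) u).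
  apply: torus_lift_unique; try exact: differentiable_continuous.
  near=> z; have /torus_graphE[/= _ <-] : torus_graph B f (Defs.cover (g z)) by near: z.
  by rewrite -Lf //; near: z.
have : 'J (lsubmx \o g) u = 'J (L \o (rsubmx \o g)) u.
  by rewrite (near_eq_jacobian lr dl) jacobianD_cst.
rewrite (jacobian_comp dr dL) (jacobian_rsubmx dg) (jacobian_lsubmx dg) => lJ.
rewrite -[LHS]hsubmxK mul_mx_row mulmx1; congr row_mx.
by rewrite lJ -JL.
Unshelve. all: by end_near. Qed.

(** M is the y-block of the Jacobian of [g]; it is invertible because [g] is an immersion. *)
Lemma local_param_graph U g u : local_param S U g -> U u -> exists2 M : 'M[R]_4,
  M \in unitmx & 'J g u = M *m graph_mx (P (rsubmx (g u : 'rV_(3 + 4)))).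
Proof.
move=> [oU sg frg _ og] Uu; have dg := smooth_on_differentiable sg Uu.
have SU : \forall z \near u, S (Defs.cover (g z)).
  (* Applied to [U] itself, the openness condition shows that [g] maps [U] into the graph. *)
  have [W [_ gW]] := og U oU (@subset_refl _ U).
  apply: filterS (open_nbhs_nbhs (conj oU Uu)) => z Uz.
  have : ((@Defs.cover R \o g) @` U) (Defs.cover (g z)) by exists z.
  by rewrite gW => -[].
have JE := jacobian_torus_graph dg SU.
exists (rsubmx ('J g u : 'M[R]_(4, 3 + 4))); last exact: JE.
by have := frg u Uu; rewrite {1}JE row_free_mull //; exact: row_free_graph_mx.
Qed.

Lemma coassociative_defect : coassociative B S ->
  forall y, B y -> forall a, (a < 4)%N -> defect (entries (P y)) a = 0.
Proof.
move=> [_ [A [[A_param A_cover _] A_cal]]] y By.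
have [U [g [u [AUg Uu gu]]]] :
    exists U g u, [/\ A (U, g), U u & Defs.cover (g u) = (y, f y)].
  by apply: A_cover; exists y.
have [M M_unit JE] := local_param_graph (A_param _ _ AUg) Uu.
have := A_cal _ _ _ AUg Uu; rewrite JE.
rewrite (_ : rsubmx _ = y); last by case: gu.
by move/calibrated_mulmx_graph => /(_ M_unit)[].
Qed.

(** [P z] is defined by a lift chosen separately at each [z]. Reading a given lift [L] as a
    parametrization of the graph shows that its derivative is [P] on all of [U]. *)
Lemma jacobian_lift (U : set 'rV[R]_4) L : open U -> U `<=` B -> smooth_on U L ->
  (forall z, U z -> to_torus (L z) = f z) -> forall z, U z -> 'J L z = P z.
Proof.
move=> oU UB sL Lf z Uz; pose g := graph_param L 1%:M.
have dL := smooth_on_differentiable sL Uz.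
have gE w : g w = row_mx (L w) w by rewrite /g /graph_param mulmx1.
have dg : differentiable g z.
  have := smooth_graph_param 1%:M oU sL => /smooth_on_differentiable; apply.
  by rewrite /= mulmx1.
have Sg : \forall w \near z, S (Defs.cover (g w)).
  apply: filterS (open_nbhs_nbhs (conj oU Uz)) => w Uw.
  by exists w; [exact: UB|rewrite /Defs.cover gE row_mxKl row_mxKr Lf].
have := jacobian_torus_graph dg Sg.
rewrite jacobian_graph_param ?mulmx1 // mul1mx gE row_mxKr.
by rewrite {2}/graph_mx row_mxKr mul1mx => /eq_row_mx[].
Qed.

Let Phi z := form_eval (hodge (phiG2 R)) (graph_mx (P z)).

(** On the domain of one lift, [Phi] is a polynomial in first derivatives of a smooth map, hence
    continuous, and its sign persists nearby. *)
Lemma open_Phi_pos (U : set 'rV[R]_4) L (c : R) : open U -> U `<=` B ->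
  smooth_on U L -> (forall z, U z -> to_torus (L z) = f z) ->
  open [set z | U z /\ 0 < c * Phi z].
Proof.
move=> oU UB sL Lf; rewrite openE => z [Uz Phi_z].
have nU : \forall w \near z, U w by exact: (open_nbhs_nbhs (conj oU Uz)).
have PhiE w : U w -> Phi w = star_eval (entries ('J L w)).
  by move=> Uw; rewrite (jacobian_lift oU UB sL Lf Uw) /Phi form_eval_graph.
have JL_cvg i j : entries ('J L w) i j @[w --> z] --> entries ('J L z) i j.
  pose h w : R := ('D_(delta_mx 0 (inord i)) L w) 0 (inord j).
  have hE w : U w -> h w = entries ('J L w) i j.
    move=> Uw; rewrite /entries jacobian_derive //.
    exact: smooth_on_differentiable sL Uw.
  apply: (@near_eq_cvg_to _ _ h); first by apply: filterS nU => w; exact: hE.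
  apply: (eq_ind _ (fun l => h @ z --> l) _ _ (hE z Uz)).
  have [_ /(_ (delta_mx 0 (inord i)))/(_ z Uz) cD] := sL 1%N.
  apply: (cvg_comp _ (fun M : 'rV[R]_3 => M 0 (inord j)) cD).
  exact: coord_continuous.
have Phi_cvg : c * star_eval (entries ('J L w)) @[w --> z] --> c * Phi z.
  rewrite PhiE //.
  exact: (cvgM (cvg_cst c) (star_eval_cvg (nbhs_filter z) JL_cvg)).
near=> w; have Uw : U w by near: w.
have cw : 0 < c * star_eval (entries ('J L w)).
  by near: w; exact: cvgr_gt Phi_cvg _ Phi_z.
split; first exact: Uw.
by rewrite [X in _ * X](PhiE w Uw).
Unshelve. all: by end_near. Qed.

Lemma local_param_lift (U : set 'rV[R]_4) L (T : 'M[R]_4) : T \in unitmx ->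
  open U -> U `<=` B -> smooth_on U L -> (forall z, U z -> to_torus (L z) = f z) ->
  local_param S [set z | U (z *m T)] (graph_param L T).
Proof.
move=> uT oU UB sL Lf; split.
- exact: open_preimage_mulmxr.
- exact: smooth_graph_param.
- move=> u Uu; have dg := smooth_on_differentiable (smooth_graph_param T oU sL) Uu.
  rewrite (jacobian_graph_param dg (smooth_on_differentiable sL Uu)).
  by rewrite row_free_mull //; exact: row_free_graph_mx.
- move=> u v _ _ /(congr1 fst); rewrite /= !row_mxKr => uv.
  by rewrite -(mulmxK uT u) uv mulmxK.
(* A graph point is determined by its base point, so W need only require that the base point lie in
   the image of [V] under [T]. *)
- move=> V oV VU; exists [set p | V (p.1 *m invmx T)]; split.
    apply: (@open_comp _ _ fst [set z | V (z *m invmx T)]).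
      by move=> p _; exact: cvg_fst.
    exact: open_preimage_mulmxr.
  apply/seteqP; split=> [_ [z Vz <-]|p [/torus_graphE[Bp fp] /= Vp]].
    rewrite /= /Defs.cover /graph_param row_mxKl row_mxKr /= mulmxK //; split => //.
    by exists (z *m T); [exact/UB/VU|rewrite Lf //; exact: VU].
  exists (p.1 *m invmx T) => //; rewrite /= /Defs.cover /graph_param.
  have := VU _ Vp; rewrite /= mulmxKV // row_mxKl row_mxKr => Up.
  by rewrite Lf // fp -surjective_pairing.
Qed.

Lemma defect_coassociative :
  (forall y, B y -> forall a, (a < 4)%N -> defect (entries (P y)) a = 0) ->
  coassociative B S.
Proof.
move=> defect0; split=> [p /torus_graphE[Bp _]|]; first by split.
(* The parametrizations on which *phi is the volume form: near a given point,
   z |-> (L (z T), z T) is one for a lift L of f and a T of suitable sign. *)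
exists [set Ug | local_param S Ug.1 Ug.2 /\ forall u, Ug.1 u ->
  form_eval (hodge (phiG2 R)) ('J Ug.2 u)
  = Num.sqrt (\det ('J Ug.2 u *m ('J Ug.2 u)^T))].
split; last by move=> U g u [_]; exact.
split=> [U g []//|p /torus_graphE[By fy]|U g V h u v [pg cg] [ph ch] Uu Vv gh].
  set y := p.1 in By fy.
  have [L [U [oU Uy UB sL Lf]]] := smoothf By.
  have [T T_sign] : exists T : 'M[R]_4, 0 < \det T * Phi y.
    (* [Phi y] is nonzero: its square is the Gram determinant, as the defects vanish. *)
    apply: exists_det_sign; rewrite -sqrf_eq0 gt_eqF //.
    by have /calibrated_graph -> := defect0 y By; exact: det_gram_graph_gt0.
  have uT : T \in unitmx.
    by rewrite unitmxE unitfE; apply: contraTneq T_sign => ->; rewrite mul0r ltxx.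
  (* The domain is shrunk so that the sign chosen at [y] is right throughout. *)
  pose U' := [set z | U z /\ 0 < \det T * Phi z].
  have oU' : open U' by exact: open_Phi_pos sL Lf.
  have U'B : U' `<=` B by move=> z [/UB].
  have sL' : smooth_on U' L by move=> k; apply: Ck_on_subset (sL k) => z [].
  have Lf' z : U' z -> to_torus (L z) = f z by move=> [/Lf].
  have param := local_param_lift uT oU' U'B sL' Lf'.
  exists [set z | U' (z *m T)], (graph_param L T), (y *m invmx T).
  split; last 2 first.
  - by rewrite /= mulmxKV.
  - rewrite /Defs.cover /graph_param mulmxKV // row_mxKl row_mxKr Lf // fy.
    by rewrite -surjective_pairing.
  split; first exact: param.
  move=> u Uu; have Tu : U' (u *m T) by exact: Uu.
  have dL := smooth_on_differentiable sL' Tu.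
  have dg := smooth_on_differentiable (smooth_graph_param T oU' sL') Tu.
  have JE : 'J (graph_param L T) u = T *m graph_mx (P (u *m T)).
    by rewrite (jacobian_graph_param dg dL) (jacobian_lift oU' U'B sL' Lf' Tu).
  rewrite /= JE; apply/(calibrated_mulmx_graph _ uT).
  by split; [case: Tu|exact/defect0/U'B].
(* Orientations agree: both charts are calibrated, so det M and det N have the sign of [Phi] at the
   common base point, and M N^-1 has positive determinant. *)
rewrite /= in pg cg ph ch Uu Vv.
have [M uM JM] := local_param_graph pg Uu.
have [N uN JN] := local_param_graph ph Vv.
have yE : rsubmx (g u : 'rV_(3 + 4)) = rsubmx (h v : 'rV_(3 + 4)) by case: gh.
have := cg u Uu; rewrite JM => /(calibrated_mulmx_graph _ uM)[+ _].
have := ch v Vv; rewrite JN => /(calibrated_mulmx_graph _ uN)[+ _].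
rewrite yE => N_sign M_sign; exists (M *m invmx N); last first.
  have MN := mulmxKV uN M.
  rewrite [RHS]mulmxA MN; reflexivity.
have N0 : \det N != 0 by rewrite -unitfE -unitmxE.
set c := form_eval _ _ in N_sign M_sign.
have c0 : c != 0 by apply: contraTneq N_sign => ->; rewrite mulr0 ltxx.
rewrite det_mulmx det_inv.
have -> : \det M / \det N = (\det M * c) * (\det N * c) / (\det N * c) ^+ 2.
  by field; rewrite c0 N0.
by apply: divr_gt0; [exact: mulr_gt0|exact: exprn_gt0].
Qed.

End Graph.

(** * Equivalence of the three conditions through vanishing of the defects *)

Theorem proposition6p1 (R : realType) (B : set 'rV[R]_4)
    (f : 'rV[R]_4 -> torus3 R) (openB : open B) (smoothf : smooth_to_torus B f) :
  let F := curvature B f in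
  let star := @hodge R[i] 7 in
  let phi := phiG2 R[i] in
  let dDT := forall p, totalX B p ->
    6^-1 *: wedge_exp (F p) 3 + F p \wedge star phi = 0 in
  let dDT' := forall p, totalX B p -> phi \wedge star (wedge_exp (F p) 2) = 0 in
  (coassociative B (torus_graph B f) <-> dDT) /\ (dDT <-> dDT /\ dDT').
Proof.
move=> F star phi dDT dDT'.
pose P := torus_derivative B f.
have FE p : F p = 'i%C *: \sum_(j < 3) \sum_(a < 4)
    (P p.1 a j)%:C%C *: (d_ R[i] (a + 4) \wedge d_ R[i] j.+1).
  congr (_ *: _); apply: eq_bigr => j _; apply: eq_bigr => a _.
  by rewrite mxE.
have dDT_defectP :
    dDT <-> forall y, B y -> forall a, (a < 4)%N -> defect (entries (P y)) a = 0.
  split=> [h y By|h p [Bp _]].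
    (* The curvature at a point depends only on its base point, so any point of the fibre over [y]
       can be tested. *)
    have := h (y, f y) (conj By I); rewrite FE.
    by move/dDT_defect.
  by rewrite FE; apply/dDT_defect/h.
split.
  rewrite dDT_defectP; split; first exact: coassociative_defect.
  exact: defect_coassociative.
split=> [h|[]//]; split=> // p [Bp _].
by rewrite FE; apply: defect_dDT'; move/dDT_defectP: h; apply.
Qed.
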